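(* Consider the plant $x[t+1]=Ax[t]+Bu[t]+\delta_x[t]$, $y[t]=Cx[t]+\delta_y[t]$ with $(A,B)$ stabilizable and $(A,C)$ detectable, $\mathbf{G}=C(zI-A)^{-1}B$, evolving under a dynamic control policy $\mathbf{u}=\mathbf{K}\mathbf{y}+\delta_u$. Consider the following constraints on transfer matrices $\boldsymbol{\Phi}_{yx},\boldsymbol{\Phi}_{ux},\boldsymbol{\Phi}_{yy},\boldsymbol{\Phi}_{uy}$: $$\begin{bmatrix} I & -\mathbf{G}\end{bmatrix}\begin{bmatrix}\boldsymbol{\Phi}_{yx}&\boldsymbol{\Phi}_{yy}\\ \boldsymbol{\Phi}_{ux}&\boldsymbol{\Phi}_{uy}\end{bmatrix}=\begin{bmatrix}C(zI-A)^{-1}& I\end{bmatrix},\qquad \begin{bmatrix}\boldsymbol{\Phi}_{yx}&\boldsymbol{\Phi}_{yy}\\ \boldsymbol{\Phi}_{ux}&\boldsymbol{\Phi}_{uy}\end{bmatrix}\begin{bmatrix}zI-A\\ -C\end{bmatrix}=0,\qquad \boldsymbol{\Phi}_{yx},\boldsymbol{\Phi}_{ux},\boldsymbol{\Phi}_{yy},\boldsymbol{\Phi}_{uy}\in\mathcal{RH}_\infty.\quad( * )$$ Then: (1) For any $\mathbf{K}\in\mathcal{C}_{\mathrm{stab}}$, the resulting closed-loop responses $\boldsymbol{\Phi}_{yx},\boldsymbol{\Phi}_{yy},\boldsymbol{\Phi}_{ux},\boldsymbol{\Phi}_{uy}$ from $(\delta_x,\delta_y)$ to $(\mathbf{y},\mathbf{u})$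 satisfy $( * )$. (2) For any transfer matrices $\boldsymbol{\Phi}_{yx},\boldsymbol{\Phi}_{ux},\boldsymbol{\Phi}_{yy},\boldsymbol{\Phi}_{uy}$ satisfying $( * )$, $\mathbf{K}=\boldsymbol{\Phi}_{uy}\boldsymbol{\Phi}_{yy}^{-1}\in\mathcal{C}_{\mathrm{stab}}$.
   Context: All systems are discrete-time, linear time-invariant with real matrices; $x[t]\in\mathbb{R}^n$, $u[t]\in\mathbb{R}^m$, $y[t]\in\mathbb{R}^p$; $\delta_x,\delta_y,\delta_u$ are external disturbances. A controller is $\xi[t+1]=A_k\xi[t]+B_ky[t]$, $u[t]=C_k\xi[t]+D_ky[t]+\delta_u[t]$, with $\mathbf{K}=C_k(zI-A_k)^{-1}B_k+D_k$; its realization is always taken with $(A_k,B_k)$ stabilizable and $(A_k,C_k)$ detectable. $\mathbf{K}$ internally stabilizes $\mathbf{G}$ if $(x[t],\xi[t])\to0$ as $t\to\infty$ for all initial states when all disturbances are zero. $\mathcal{C}_{\mathrm{stab}}$ is the set of all (proper real-rational) $\mathbf{K}$ that internally stabilize $\mathbf{G}$. $\mathcal{RH}_\infty$ is the set of real-rational proper stable transfer matrices (all poles of modulus $<1$). The closed-loop responses ($\boldsymbol{\Phi}_{ab}$ is from $\delta_b$ to $\mathbf{a}$) are $\boldsymbol{\Phi}_{yx}=C\boldsymbol{\Phi}_{xx}$, $\boldsymbol{\Phi}_{yy}=C\boldsymbol{\Phi}_{xx}B\mathbf{K}+I$, $\boldsymbol{\Phi}_{ux}=\mathbf{K}C\boldsymbol{\Phi}_{xx}$,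 $\boldsymbol{\Phi}_{uy}=\mathbf{K}(C\boldsymbol{\Phi}_{xx}B\mathbf{K}+I)$, where $\boldsymbol{\Phi}_{xx}=(zI-A-B\mathbf{K}C)^{-1}$. *)

(* Defs.v *)
From HB Require Import structures.
From mathcomp Require Import all_boot all_order all_algebra.
From mathcomp Require Import classical_sets reals topology normedtype.
From mathcomp Require Import complex.

Set Implicit Arguments.
Unset Strict Implicit.
Unset Printing Implicit Defensive.

Import Order.TTheory GRing.Theory Num.Theory.
Import numFieldNormedType.Exports.

Local Open Scope classical_set_scope.
Local Open Scope ring_scope.

(* Real-rational functions of the variable z are elements of the fraction
   field of R[X], with z = 'X. *)
Notation ratfun R := {fraction {poly R}}.
Local Notation tofrac := (@FracField.tofrac _).
Local Notation "x %:F" := (tofrac x).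

Section Defs.
Variable R : realType.

Definition zvar : ratfun R := 'X%:F.

Definition constmx a b (M : 'M[R]_(a, b)) : 'M[ratfun R]_(a, b) :=
  map_mx (tofrac \o polyC) M.

Definition proper (f : ratfun R) : Prop :=
  exists p q : {poly R}, [/\ q != 0, f = p%:F / q%:F & (size p <= size q)%N].

Definition pole (f : ratfun R) (lam : R[i]) : Prop :=
  exists p q : {poly R}, [/\ q != 0, f = p%:F / q%:F, coprimep p q
    & root (map_poly (real_complex R) q) lam].

Definition proper_mx a b (M : 'M[ratfun R]_(a, b)) : Prop :=
  forall i j, proper (M i j).

Definition RHinf a b (M : 'M[ratfun R]_(a, b)) : Prop :=
  proper_mx M /\ forall i j (lam : R[i]), pole (M i j) lam -> `|lam| < 1.

Definition schur n (A : 'M[R]_n) : Prop :=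
  forall lam : R[i], eigenvalue (map_mx (real_complex R) A) lam -> `|lam| < 1.

Definition stabilizable n m (A : 'M[R]_n) (B : 'M[R]_(n, m)) : Prop :=
  exists F : 'M[R]_(m, n), schur (A + B *m F).

Definition detectable n p (A : 'M[R]_n) (C : 'M[R]_(p, n)) : Prop :=
  exists L : 'M[R]_(n, p), schur (A + L *m C).

(* (zI - A)^-1; zI - A is always invertible over the field of rational
   functions, its determinant being the characteristic polynomial of A. *)
Definition resolvent n (A : 'M[R]_n) : 'M[ratfun R]_n :=
  invmx (zvar%:M - constmx A).

Definition transfer n m p (A : 'M[R]_n) (B : 'M[R]_(n, m)) (C : 'M[R]_(p, n))
    (D : 'M[R]_(p, m)) : 'M[ratfun R]_(p, m) :=
  constmx C *m resolvent A *m constmx B + constmx D.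

(* Internal stability of the undisturbed loop of the plant (A, B, C) with the
   controller (Ak, Bk, Ck, Dk). *)
Definition internally_stable n m p k
    (A : 'M[R]_n) (B : 'M[R]_(n, m)) (C : 'M[R]_(p, n))
    (Ak : 'M[R]_k) (Bk : 'M[R]_(k, p)) (Ck : 'M[R]_(m, k))
    (Dk : 'M[R]_(m, p)) : Prop :=
  forall (x : nat -> 'cV[R]_n) (xi : nat -> 'cV[R]_k)
         (u : nat -> 'cV[R]_m) (y : nat -> 'cV[R]_p),
    (forall t, x t.+1 = A *m x t + B *m u t) ->
    (forall t, y t = C *m x t) ->
    (forall t, xi t.+1 = Ak *m xi t + Bk *m y t) ->
    (forall t, u t = Ck *m xi t + Dk *m y t) ->
    x @ \oo --> (0 : 'cV[R]_n) /\ xi @ \oo --> (0 : 'cV[R]_k).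

(* K internally stabilizes the plant when it is the transfer matrix of a
   stabilizable and detectable controller whose loop with the plant is
   internally stable. State dimension k = 0 gives the static controllers. *)
Definition internally_stabilizes n m p
    (A : 'M[R]_n) (B : 'M[R]_(n, m)) (C : 'M[R]_(p, n))
    (K : 'M[ratfun R]_(m, p)) : Prop :=
  exists (k : nat) (Ak : 'M[R]_k) (Bk : 'M[R]_(k, p)) (Ck : 'M[R]_(m, k))
         (Dk : 'M[R]_(m, p)),
    [/\ K = transfer Ak Bk Ck Dk, stabilizable Ak Bk, detectable Ak Ck
      & internally_stable A B C Ak Bk Ck Dk].

Definition Cstab n m p (A : 'M[R]_n) (B : 'M[R]_(n, m)) (C : 'M[R]_(p, n))
    (K : 'M[ratfun R]_(m, p)) : Prop :=
  proper_mx K /\ internally_stabilizes A B C K.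

Section ClosedLoop.
Variables (n m p : nat).
Variables (A : 'M[R]_n) (B : 'M[R]_(n, m)) (C : 'M[R]_(p, n)).
Variable K : 'M[ratfun R]_(m, p).

(* The inverse is a genuine one for every proper K, K being fed back through
   a strictly proper plant. *)
Definition Phi_xx : 'M[ratfun R]_n :=
  invmx (zvar%:M - constmx A - constmx B *m K *m constmx C).

Definition Phi_yx : 'M[ratfun R]_(p, n) := constmx C *m Phi_xx.

Definition Phi_yy : 'M[ratfun R]_p :=
  constmx C *m Phi_xx *m constmx B *m K + 1%:M.

Definition Phi_ux : 'M[ratfun R]_(m, n) := K *m constmx C *m Phi_xx.

Definition Phi_uy : 'M[ratfun R]_(m, p) :=
  K *m (constmx C *m Phi_xx *m constmx B *m K + 1%:M).

End ClosedLoop.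

Definition response_constraints n m p
    (A : 'M[R]_n) (B : 'M[R]_(n, m)) (C : 'M[R]_(p, n))
    (Pyx : 'M[ratfun R]_(p, n)) (Pux : 'M[ratfun R]_(m, n))
    (Pyy : 'M[ratfun R]_p) (Puy : 'M[ratfun R]_(m, p)) : Prop :=
  let G := transfer A B C 0 in
  let Phi := block_mx Pyx Pyy Pux Puy in
  [/\ row_mx 1%:M (- G) *m Phi = row_mx (constmx C *m resolvent A) 1%:M,
      Phi *m col_mx (zvar%:M - constmx A) (- constmx C) = 0
    & [/\ RHinf Pyx, RHinf Pux, RHinf Pyy & RHinf Puy]].

End Defs.

(* Main.v *)
(* For (1), the loop of the plant with a realization of K is a linear system
   with state matrix Acl.  Internal stability forces Acl to be Schur (pair the
   trajectories with a left eigenvector), and all four responses are transfer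
   matrices with state matrix Acl, hence stable; the two affine constraints are
   identities for (zI - A - BKC)^-1.

   For (2), no minimal realization of K is computed.  Choose F and L with A + BF
   and A + LC Schur and form the Youla parameter
     Q = W - F (zI - A - LC)^-1 (B W - L V),
   where W = Phi_uy - Phi_ux L and V = Phi_yy - Phi_yx L.  It is stable, hence
   has a Schur realization, and the observer-based controller built on F, L and
   this realization has transfer matrix Kc with Kc Phi_yy = Phi_uy.  Then
   Phi_yy - G Phi_uy = I reads (I - G Kc) Phi_yy = I, so that Phi_yy is
   invertible and K = Kc.  The loop is a cascade of the Schur matrices A + LC,
   Aq and A + BF, and the controller is stabilizable and detectable because
   the feedback y = C xhat and the output injection - B u into the xhat equation
   make it block triangular. *)

Require Import Defs.
From mathcomp Require Import all_boot all_order all_algebra.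
From mathcomp Require Import classical_sets reals topology normedtype.
From mathcomp Require Import complex.
From mathcomp Require Import ring perm boolp sequences.

Set Implicit Arguments.
Unset Strict Implicit.
Unset Printing Implicit Defensive.

Import Order.TTheory GRing.Theory Num.Theory.
Import numFieldNormedType.Exports.

Local Open Scope classical_set_scope.
Local Open Scope ring_scope.

Local Notation "x %:F" := (@FracField.tofrac _ x).

(** * Proper rational functions with constrained denominators *)

Section ProperOver.
Variable R : realType.
Variable P : {poly R} -> Prop.
Hypotheses (P1 : P 1) (PM : forall p q, P p -> P q -> P (p * q)).

(** The predicate [P] on denominators lets properness ([P] always true) and membership in
    RH-infinity ([P] is [stable_poly]) share their closure lemmas. The fraction may be unreduced, so
    sums and products only multiply denominators. *)
Definition proper_over (f : ratfun R) : Prop :=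
  exists p q : {poly R}, [/\ q != 0, P q, f = p%:F / q%:F & (size p <= size q)%N].

Definition proper_over_mx a b (M : 'M[ratfun R]_(a, b)) : Prop :=
  forall i j, proper_over (M i j).

Lemma proper_overC (c : R) : proper_over c%:P%:F.
Proof.
exists c%:P, 1; split=> //; first exact: oner_neq0.
  by rewrite tofrac1 divr1.
by rewrite size_poly1 size_polyC_leq1.
Qed.

Lemma proper_overD f g : proper_over f -> proper_over g -> proper_over (f + g).
Proof.
move=> [p [q [q0 Pq -> sp]]] [r [s [s0 Ps -> sr]]].
exists (p * s + r * q), (q * s); split; first by rewrite mulf_neq0.
- exact: PM.
- rewrite tofracD !tofracM addf_div ?tofrac_eq0 //.
- have qs : (0 < size q)%N by rewrite size_poly_gt0.
  have ss : (0 < size s)%N by rewrite size_poly_gt0.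
  rewrite (size_mul q0 s0) (leq_trans (size_polyD _ _)) // geq_max.
  apply/andP; split; apply: leq_trans (size_polyMleq _ _) _.
    by rewrite -!subn1 leq_sub2r // leq_add2r.
  by rewrite -!subn1 leq_sub2r // addnC leq_add2l.
Qed.

Lemma proper_overM f g : proper_over f -> proper_over g -> proper_over (f * g).
Proof.
move=> [p [q [q0 Pq -> sp]]] [r [s [s0 Ps -> sr]]].
exists (p * r), (q * s); split; first by rewrite mulf_neq0.
- exact: PM.
- by rewrite !tofracM mulf_div.
- rewrite (size_mul q0 s0) (leq_trans (size_polyMleq _ _)) //.
  by rewrite -!subn1 leq_sub2r // leq_add.
Qed.

Lemma proper_over_constmx a b (M : 'M[R]_(a, b)) : proper_over_mx (constmx M).
Proof. by move=> i j; rewrite mxE; apply: proper_overC. Qed.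

Lemma proper_over_addmx a b (M N : 'M[ratfun R]_(a, b)) :
  proper_over_mx M -> proper_over_mx N -> proper_over_mx (M + N).
Proof. by move=> hM hN i j; rewrite mxE; apply: proper_overD. Qed.

Lemma proper_over_mulmx a b c (M : 'M[ratfun R]_(a, b)) (N : 'M_(b, c)) :
  proper_over_mx M -> proper_over_mx N -> proper_over_mx (M *m N).
Proof.
move=> hM hN i j; rewrite mxE; apply: (big_ind proper_over).
- by rewrite -tofrac0 -polyC0; apply: proper_overC.
- exact: proper_overD.
- by move=> k _; apply: proper_overM.
Qed.

Lemma proper_over_oppmx a b (M : 'M[ratfun R]_(a, b)) :
  proper_over_mx M -> proper_over_mx (- M).
Proof.
move=> hM i j; rewrite mxE -mulN1r; apply: proper_overM => //.
by rewrite -tofrac1 -tofracN -polyC1 -polyCN; apply: proper_overC.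
Qed.

End ProperOver.

Lemma zvar_constmxE (R : realType) n (A : 'M[R]_n) :
  (@zvar R)%:M - constmx A = map_mx (@FracField.tofrac _) (char_poly_mx A).
Proof. by rewrite /char_poly_mx map_mxB map_scalar_mx /constmx map_mx_comp. Qed.

Lemma zvar_constmx_unit (R : realType) n (A : 'M[R]_n) :
  (@zvar R)%:M - constmx A \in unitmx.
Proof.
rewrite zvar_constmxE unitmxE det_map_mx unitfE tofrac_eq0.
exact/monic_neq0/char_poly_monic.
Qed.

Lemma size_det_leq (R : comNzRingType) n (M : 'M[{poly R}]_n) :
  (forall i j, size (M i j) <= 2)%N -> (size (\det M)%R <= n.+1)%N.
Proof.
move=> hM; apply: (leq_trans (size_sum _ _ _)); apply/bigmax_leqP => s _.
rewrite -signr_odd mulr_sign.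
have h : (size (\prod_i M i (s i))%R <= n.+1)%N.
  apply: (leq_trans (size_poly_prod_leq _ _)).
  rewrite leq_subLR (@leq_trans (\sum_(i < n) 2).+1) //.
    by rewrite ltnS leq_sum.
  by rewrite sum_nat_const !card_ord muln2 -addnn addnS.
by case: ifP => // _; rewrite size_polyN.
Qed.

(** Cramer's rule: each entry is a cofactor over [char_poly A], and the cofactor is a minor with
    entries of degree at most 1. *)
Lemma proper_over_resolvent (R : realType) (P : {poly R} -> Prop) n
    (A : 'M[R]_n) : P (char_poly A) -> proper_over_mx P (resolvent A).
Proof.
move=> PA i j; rewrite /resolvent /invmx zvar_constmx_unit zvar_constmxE.
rewrite det_map_mx -map_mx_adj !mxE.
exists (cofactor (char_poly_mx A) j i), (char_poly A).
have cA0 : char_poly A != 0 by exact/monic_neq0/char_poly_monic.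
split=> //; first by rewrite mulrC.
rewrite size_char_poly /cofactor -signr_odd mulr_sign.
suff h : (size (\det (row' j (col' i (char_poly_mx A)))) <= n.+1)%N.
  by case: ifP => // _; rewrite size_polyN.
apply: leq_trans (size_det_leq _) _.
  move=> k l; rewrite !mxE (leq_trans (size_polyD _ _)) // geq_max size_polyN.
  rewrite (leq_trans (size_polyC_leq1 _)) // andbT.
  by case: eqP => _; rewrite ?mulr1n ?size_polyX // mulr0n size_poly0.
by rewrite ltnS leq_pred.
Qed.

Lemma proper_over_transfer (R : realType) (P : {poly R} -> Prop)
    (P1 : P 1) (PM : forall p q, P p -> P q -> P (p * q)) n m p
    (A : 'M[R]_n) (B : 'M_(n, m)) (C : 'M_(p, n)) D :
  P (char_poly A) -> proper_over_mx P (transfer A B C D).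
Proof.
move=> PA; apply: proper_over_addmx => //; last exact: proper_over_constmx.
apply: proper_over_mulmx => //; last exact: proper_over_constmx.
apply: proper_over_mulmx => //; first exact: proper_over_constmx.
exact: proper_over_resolvent.
Qed.

Lemma proper_transfer (R : realType) n m p
    (A : 'M[R]_n) (B : 'M_(n, m)) (C : 'M_(p, n)) D :
  proper_mx (transfer A B C D).
Proof.
move=> i j.
have h : proper_over_mx (fun=> True) (transfer A B C D).
  exact: proper_over_transfer.
by have [a [b [b0 _ ab sab]]] := h i j; exists a, b.
Qed.

(** * Stable denominators and RH-infinity *)

Section StablePoly.
Variable R : realType.

Definition stable_poly (q : {poly R}) : Prop :=
  forall lam : R[i], root (map_poly (real_complex R) q) lam -> `|lam| < 1.

Lemma stable_poly1 : stable_poly 1.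
Proof. by move=> lam; rewrite rmorph1 (negbTE (root1 _)). Qed.

Lemma stable_polyM p q : stable_poly p -> stable_poly q -> stable_poly (p * q).
Proof. by move=> hp hq lam; rewrite rmorphM /= rootM => /orP[/hp|/hq]. Qed.

Lemma stable_char_poly n (A : 'M[R]_n) : schur A <-> stable_poly (char_poly A).
Proof.
by split=> h lam; have := h lam; rewrite eigenvalue_root_char map_char_poly.
Qed.

(** Forwards, dividing out the gcd makes every root of the denominator a pole. Backwards, by Gauss'
    lemma the denominator of a coprime form divides any other denominator, so each pole is a root of
    the stable one. *)
Lemma RHinfP a b (M : 'M[ratfun R]_(a, b)) :
  RHinf M <-> proper_over_mx stable_poly M.
Proof.
split=> [[Mp Ms] i j|h].
  have [p [q [q0 Mij spq]]] := Mp i j.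
  have g0 : gcdp p q != 0 by rewrite gcdp_eq0 negb_and q0 orbT.
  have [ep eq] : p = p %/ gcdp p q * gcdp p q /\ q = q %/ gcdp p q * gcdp p q.
    by rewrite !divpK ?dvdp_gcdl ?dvdp_gcdr.
  have q'0 : q %/ gcdp p q != 0.
    by apply: contraNneq q0 => e; rewrite eq e mul0r.
  have cop : coprimep (p %/ gcdp p q) (q %/ gcdp p q).
    by rewrite coprimep_div_gcd // q0 orbT.
  have Mij' : M i j = (p %/ gcdp p q)%:F / (q %/ gcdp p q)%:F.
    rewrite Mij [in LHS]ep [X in _ / X%:F]eq !tofracM -mulf_div divff ?mulr1 //.
    by rewrite tofrac_eq0.
  exists (p %/ gcdp p q), (q %/ gcdp p q); split=> //.
    by move=> lam hl; apply: (Ms i j); exists (p %/ gcdp p q), (q %/ gcdp p q).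
  by rewrite !size_divp // leq_sub2r.
split=> [i j|i j lam]; first by have [p [q [? _ ? ?]]] := h i j; exists p, q.
have [p [q [q0 sq -> _]]] := h i j.
move=> [r [s [s0 /eqP + cop rs]]].
rewrite eqr_div ?tofrac_eq0 // -!tofracM tofrac_eq => /eqP e.
have /dvdpP[c ec] : s %| q.
  by rewrite -(@Gauss_dvdpr _ _ r) 1?coprimep_sym // -e dvdp_mull.
by apply: sq; rewrite ec rmorphM /= rootM rs orbT.
Qed.

Lemma RHinf_constmx a b (M : 'M[R]_(a, b)) : RHinf (constmx M).
Proof. by apply/RHinfP/proper_over_constmx/stable_poly1. Qed.

Lemma RHinf_addmx a b (M N : 'M[ratfun R]_(a, b)) :
  RHinf M -> RHinf N -> RHinf (M + N).
Proof.
move=> /RHinfP hM /RHinfP hN; apply/RHinfP.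
by apply: proper_over_addmx => //; apply: stable_polyM.
Qed.

Lemma RHinf_oppmx a b (M : 'M[ratfun R]_(a, b)) : RHinf M -> RHinf (- M).
Proof.
move=> /RHinfP hM; apply/RHinfP.
by apply: proper_over_oppmx => //; [apply: stable_poly1|apply: stable_polyM].
Qed.

Lemma RHinf_mulmx a b c (M : 'M[ratfun R]_(a, b)) (N : 'M_(b, c)) :
  RHinf M -> RHinf N -> RHinf (M *m N).
Proof.
move=> /RHinfP hM /RHinfP hN; apply/RHinfP.
by apply: proper_over_mulmx => //; [apply: stable_poly1|apply: stable_polyM].
Qed.

Lemma RHinf_resolvent n (A : 'M[R]_n) : schur A -> RHinf (resolvent A).
Proof. by move/stable_char_poly=> sA; apply/RHinfP/proper_over_resolvent. Qed.

Lemma RHinf_col_mx a1 a2 b (M : 'M[ratfun R]_(a1, b)) (N : 'M_(a2, b)) :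
  RHinf M -> RHinf N -> RHinf (col_mx M N).
Proof.
move=> /RHinfP hM /RHinfP hN; apply/RHinfP => i j.
by rewrite mxE; case: split.
Qed.

Lemma RHinf_usubmx a1 a2 b (M : 'M[ratfun R]_(a1 + a2, b)) :
  RHinf M -> RHinf (usubmx M).
Proof. by move=> /RHinfP hM; apply/RHinfP => i j; rewrite mxE. Qed.

Lemma RHinf_dsubmx a1 a2 b (M : 'M[ratfun R]_(a1 + a2, b)) :
  RHinf M -> RHinf (dsubmx M).
Proof. by move=> /RHinfP hM; apply/RHinfP => i j; rewrite mxE. Qed.

End StablePoly.

(** * State-space realizations *)

Section Constmx.
Variable R : realType.
Implicit Types a b c : nat.

Lemma constmxM a b c (M : 'M[R]_(a, b)) (N : 'M_(b, c)) :
  constmx (M *m N) = constmx M *m constmx N.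
Proof. by rewrite /constmx map_mxM. Qed.

Lemma constmxD a b (M N : 'M[R]_(a, b)) : constmx (M + N) = constmx M + constmx N.
Proof. by rewrite /constmx map_mxD. Qed.

Lemma constmxN a b (M : 'M[R]_(a, b)) : constmx (- M) = - constmx M.
Proof. by rewrite /constmx map_mxN. Qed.

Lemma constmx0 a b : constmx (0 : 'M[R]_(a, b)) = 0.
Proof. by rewrite /constmx map_mx0. Qed.

Lemma constmx1 a : constmx (1%:M : 'M[R]_a) = 1%:M.
Proof. by rewrite /constmx map_mx1. Qed.

Lemma constmx_block a1 a2 b1 b2 (M : 'M[R]_(a1, b1)) (N : 'M_(a1, b2))
    (M' : 'M_(a2, b1)) (N' : 'M_(a2, b2)) :
  constmx (block_mx M N M' N')
    = block_mx (constmx M) (constmx N) (constmx M') (constmx N').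
Proof. by rewrite /constmx map_block_mx. Qed.

Lemma constmx_row a b1 b2 (M : 'M[R]_(a, b1)) (N : 'M_(a, b2)) :
  constmx (row_mx M N) = row_mx (constmx M) (constmx N).
Proof. by rewrite /constmx map_row_mx. Qed.

Lemma constmx_col a1 a2 b (M : 'M[R]_(a1, b)) (N : 'M_(a2, b)) :
  constmx (col_mx M N) = col_mx (constmx M) (constmx N).
Proof. by rewrite /constmx map_col_mx. Qed.

Lemma constmx_delta a b (i : 'I_a) (j : 'I_b) :
  constmx (delta_mx i j : 'M[R]_(a, b)) = delta_mx i j.
Proof. by rewrite /constmx map_delta_mx. Qed.

Lemma zvar_constmx_block a b (M : 'M[R]_a) (N : 'M_(a, b))
    (M' : 'M_(b, a)) (N' : 'M_b) :
  (@zvar R)%:M - constmx (block_mx M N M' N')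
    = block_mx ((@zvar R)%:M - constmx M) (- constmx N)
               (- constmx M') ((@zvar R)%:M - constmx N').
Proof.
by rewrite constmx_block scalar_mx_block opp_block_mx add_block_mx !add0r.
Qed.

Lemma resolventK n b (A : 'M[R]_n) (X : 'M_(n, b)) :
  ((@zvar R)%:M - constmx A) *m (resolvent A *m X) = X.
Proof. by rewrite mulKVmx // zvar_constmx_unit. Qed.

Lemma resolventKl n b (A : 'M[R]_n) (X : 'M_(n, b)) :
  resolvent A *m (((@zvar R)%:M - constmx A) *m X) = X.
Proof. by rewrite mulKmx // zvar_constmx_unit. Qed.

(** Reduces an identity between transfer matrices to exhibiting a state response [X], so that no
    block matrix has to be inverted. *)
Lemma transfer_state n m p b (A : 'M[R]_n) (B : 'M_(n, m)) (C : 'M_(p, n))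
    (D : 'M_(p, m)) (X : 'M_(n, b)) (V : 'M_(m, b)) :
  ((@zvar R)%:M - constmx A) *m X = constmx B *m V ->
  transfer A B C D *m V = constmx C *m X + constmx D *m V.
Proof.
move=> h; rewrite mulmxDl; congr (_ + _).
by rewrite -!mulmxA -h resolventKl.
Qed.

End Constmx.

(** * Block triangular and companion matrices *)

Lemma char_poly_lblock (R : comNzRingType) a b (M : 'M[R]_a) (M' : 'M_(b, a))
    (N' : 'M_b) :
  char_poly (block_mx M 0 M' N') = char_poly M * char_poly N'.
Proof.
rewrite /char_poly /char_poly_mx map_block_mx map_mx0 scalar_mx_block.
by rewrite opp_block_mx add_block_mx oppr0 addr0 det_lblock.
Qed.

Lemma char_poly_ublock (R : comNzRingType) a b (M : 'M[R]_a) (N : 'M_(a, b))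
    (N' : 'M_b) :
  char_poly (block_mx M N 0 N') = char_poly M * char_poly N'.
Proof.
rewrite /char_poly /char_poly_mx map_block_mx map_mx0 scalar_mx_block.
by rewrite opp_block_mx add_block_mx oppr0 addr0 det_ublock.
Qed.

Section Schur.
Variable R : realType.

Lemma schur_lblock a b (M : 'M[R]_a) (M' : 'M_(b, a)) (N' : 'M_b) :
  schur M -> schur N' -> schur (block_mx M 0 M' N').
Proof.
move=> /stable_char_poly hM /stable_char_poly hN; apply/stable_char_poly.
by rewrite char_poly_lblock; apply: stable_polyM.
Qed.

Lemma schur_ublock a b (M : 'M[R]_a) (N : 'M_(a, b)) (N' : 'M_b) :
  schur M -> schur N' -> schur (block_mx M N 0 N').
Proof.
move=> /stable_char_poly hM /stable_char_poly hN; apply/stable_char_poly.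
by rewrite char_poly_ublock; apply: stable_polyM.
Qed.

Lemma schur_mx0 (M : 'M[R]_0) : schur M.
Proof.
apply/stable_char_poly => lam.
by rewrite /char_poly det_mx00 rmorph1 (negbTE (root1 _)).
Qed.

End Schur.

(** A row before the last gives ['X * 'X^i - 'X^(i+1) = 0]; the last row reassembles [q] from its
    coefficients. Dividing by [q] gives the response of the companion system to an input on its last
    state. *)
Lemma char_poly_mx_companion (R : comNzRingType) (q : {poly R}) :
  q \is monic ->
  char_poly_mx (companionmx q) *m \col_i 'X^i
    = \col_i ((i == (size q).-2 :> nat)%:R * q).
Proof.
move=> qm; apply/matrixP => i j; rewrite !mxE.
have sq : (0 < size q)%N by rewrite size_poly_gt0 monic_neq0.
under eq_bigr => k _ do rewrite !mxE mulrDl mulNr.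
rewrite big_split /= sumrN (bigD1 i) //= eqxx mulr1n -exprS.
rewrite [X in _ + X - _]big1 ?addr0; last first.
  by move=> k ki; rewrite eq_sym (negbTE ki) mulr0n mul0r.
have [ei|ni] := eqVneq (i : nat) (size q).-2.
  rewrite mul1r -[RHS]coefK poly_def -[in RHS](prednK sq) big_ord_recr /=.
  have -> : q`_(size q).-1 = 1 by apply/eqP; move: qm; rewrite monicE.
  rewrite scale1r addrC -sumrN; congr (_ + _).
    by rewrite ei prednK // (leq_ltn_trans _ (ltn_ord i)).
  by apply: eq_bigr => k _; rewrite polyCN mulNr opprK mul_polyC.
have hi : (i.+1 < (size q).-1)%N.
  rewrite ltn_neqAle ltn_ord andbT; apply: contraNneq ni.
  by move=> /(congr1 predn) /= e; rewrite [X in X == _]e.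
rewrite mul0r (bigD1 (Ordinal hi)) //= eqxx mul1r big1 ?addr0 ?subrr //.
by move=> k; rewrite -val_eqE /= eq_sym => /negbTE ->; rewrite mul0r.
Qed.

(** * Schur realizations of stable transfer matrices *)

Section Realization.
Variable R : realType.

Definition stably_realizable m p (M : 'M[ratfun R]_(p, m)) : Prop :=
  exists k (A : 'M[R]_k) (B : 'M[R]_(k, m)) (C : 'M[R]_(p, k)) (D : 'M[R]_(p, m)),
    schur A /\ M = transfer A B C D.

Lemma stably_realizable0 m p : stably_realizable (0 : 'M[ratfun R]_(p, m)).
Proof.
exists 0, 0, 0, 0, 0; split; first exact: schur_mx0.
by rewrite /transfer !constmx0 mulmx0 addr0.
Qed.

Lemma stably_realizableD m p (M N : 'M[ratfun R]_(p, m)) :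
  stably_realizable M -> stably_realizable N -> stably_realizable (M + N).
Proof.
move=> [k [A [B [C [D [sA ->]]]]]] [l [A' [B' [C' [D' [sA' ->]]]]]].
exists (k + l), (block_mx A 0 0 A'), (col_mx B B'), (row_mx C C'), (D + D').
split; first exact: schur_lblock.
rewrite -[RHS]mulmx1.
rewrite (@transfer_state _ _ _ _ _ _ _ _ _
   (col_mx (resolvent A *m constmx B) (resolvent A' *m constmx B'))).
  by rewrite mulmx1 constmxD constmx_row mul_row_col /transfer !mulmxA addrACA.
rewrite mulmx1 zvar_constmx_block !constmx0 !oppr0 mul_block_col !mul0mx.
by rewrite !resolventK constmx_col addr0 add0r.
Qed.

Lemma mul_constmx_transfer n m p m' p' (A : 'M[R]_n) (B : 'M_(n, m))
    (C : 'M_(p, n)) (D : 'M_(p, m)) (E : 'M_(p', p)) (G : 'M_(m, m')) :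
  constmx E *m transfer A B C D *m constmx G
    = transfer A (B *m G) (E *m C) (E *m D *m G).
Proof. by rewrite /transfer !constmxM mulmxDr mulmxDl !mulmxA. Qed.

(** Controllable canonical form: a companion state matrix, whose characteristic polynomial is the
    monic denominator, with the numerator coefficients as output row. *)
Lemma stably_realizable_scalar (f : ratfun R) :
  proper_over (@stable_poly R) f -> stably_realizable (f%:M : 'M_1).
Proof.
move=> [p [q [q0 sq -> spq]]].
(* Rescaling makes the denominator monic, as the companion matrix requires. *)
pose c := (lead_coef q)^-1.
have lq0 : lead_coef q != 0 by rewrite lead_coef_eq0.
have c0 : c != 0 by rewrite invr_eq0.
pose q' := c *: q; pose p' := c *: p.
have q'm : q' \is monic by rewrite monicE lead_coefZ mulVf.
have sq' : stable_poly q'.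
  move=> lam; rewrite map_polyZ /= rootZ; first exact: sq.
  by rewrite fmorph_eq0.
have -> : p%:F / q%:F = p'%:F / q'%:F.
  rewrite /p' /q' -!mul_polyC !tofracM -mulf_div divff ?mul1r //.
  by rewrite tofrac_eq0 polyC_eq0.
have sp' : (size p' <= size q')%N by rewrite !size_scale.
move: p' q' q'm sq' sp' => {p q q0 sq spq c lq0 c0} p q qm sq sp.
have s0 : (0 < size q)%N by rewrite size_poly_gt0 monic_neq0.
(* [d] is the value of the fraction at infinity; removing it leaves the strictly proper part
   [r / q]. *)
pose d := p`_(size q).-1; pose r := p - d *: q.
have q0 : q%:F != 0 :> ratfun R by rewrite tofrac_eq0 monic_neq0.
have sr : (size r <= (size q).-1)%N.
  apply/leq_sizeP => j; rewrite leq_eqVlt coefB coefZ => /orP[/eqP <-|hj].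
    by move/monicP: (qm) => e; rewrite -/(lead_coef q) e mulr1 subrr.
  rewrite prednK // in hj.
  by rewrite !nth_default ?mulr0 ?subr0 // (leq_trans sp).
(* The state response [(1, z, z^2, ...) / q]; pairing it with the coefficients of [r] gives
   [r / q]. *)
pose X : 'cV[ratfun R]_(size q).-1 :=
  q%:F^-1 *: map_mx (@FracField.tofrac _) (\col_i 'X^i).
exists (size q).-1, (companionmx q), (\col_i (i == (size q).-2 :> nat)%:R),
  (\row_j r`_j), d%:M.
split; first by apply/stable_char_poly; rewrite companionmxK.
rewrite -[RHS]mulmx1 (@transfer_state _ _ _ _ _ _ _ _ _ X); last first.
  rewrite mulmx1 /X -scalemxAr zvar_constmxE -map_mxM char_poly_mx_companion //.
  apply/matrixP => i j; rewrite !mxE /= tofracM mulrCA mulVf // mulr1 /=.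
  by case: eqP => _; rewrite ?tofrac0 ?tofrac1 ?polyC0 ?polyC1 ?tofrac0 ?tofrac1.
rewrite mulmx1; apply/matrixP => i j; rewrite !ord1 !mxE eqxx !mulr1n.
have -> : p = r + d *: q by rewrite subrK.
rewrite tofracD mulrDl -mul_polyC tofracM mulfK //=; congr (_ + _).
rewrite -{1}(coefK r) poly_def.
under eq_bigr => k _ do rewrite !mxE /= mulrCA -tofracM mul_polyC.
rewrite -mulr_sumr mulrC -rmorph_sum /=; congr (_ * _%:F).
rewrite -!poly_def coefK; apply/polyP => k; rewrite coef_poly.
by case: ltnP => // h; rewrite nth_default // (leq_trans sr).
Qed.

(** Each entry is realized separately, placed at its position by elementary matrices on the input
    and output sides, and the results are connected in parallel. *)
Lemma RHinf_stably_realizable m p (M : 'M[ratfun R]_(p, m)) :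
  RHinf M -> stably_realizable M.
Proof.
move/RHinfP => hM; rewrite [M]matrix_sum_delta.
do 2![apply: big_ind => [||? _]; [exact: stably_realizable0
  |exact: stably_realizableD|]].
set i := (X in M X _); set j := (X in M _ X).
have [k [A [B [C [D [sA e]]]]]] := stably_realizable_scalar (hM i j).
exists k, A, (B *m delta_mx 0 j), (delta_mx i 0 *m C),
  (delta_mx i 0 *m D *m delta_mx 0 j).
split=> //; rewrite -mul_constmx_transfer -e !constmx_delta mul_mx_scalar.
by rewrite -scalemxAl mul_delta_mx.
Qed.

End Realization.

(** * Schur matrices and convergence of trajectories *)

Section Dynamics.
Variable R : realType.
Local Notation normc := (@Normc.normc R).

Lemma normc_ge0 z : 0 <= normc z.
Proof. by rewrite -lecR -[(normc z)%:C%C]/`|z| normr_ge0. Qed.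

Lemma normc_ltr1 z : (normc z < 1) = (`|z| < 1).
Proof. by rewrite -ltcR -[(normc z)%:C%C]/`|z|. Qed.

Lemma normcD z w : normc (z + w) <= normc z + normc w.
Proof. by rewrite -lecR rmorphD; exact: (ler_normD z w). Qed.

Lemma normcR (r : R) : normc r%:C%C = `|r|.
Proof. by rewrite /= expr0n addr0 sqrtr_sqr. Qed.

Lemma cvg_affine_contraction (a b : nat -> R) (r : R) :
  0 <= r -> r < 1 -> (forall t, 0 <= a t) ->
  (forall t, a t.+1 <= r * a t + b t) ->
  b @ \oo --> (0 : R) -> a @ \oo --> (0 : R).
Proof.
move=> r0 r1 a0 ha /cvgrPdist_lt b0; apply/cvgrPdist_lt => e e0.
have r1' : 0 < 1 - r by rewrite subr_gt0.
have e2 : 0 < e / 2 by rewrite divr_gt0.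
(* Once [b] is below [(1 - r) * (e / 2)], the level [e / 2] is preserved by the recurrence, and the
   excess of [a] over it decays like [r ^+ s]. *)
have [N _ hN] := b0 _ (mulr_gt0 r1' e2).
have step s : a (N + s)%N <= r ^+ s * a N + e / 2.
  elim: s => [|s IH]; first by rewrite addn0 expr0 mul1r lerDl ltW.
  rewrite addnS (le_trans (ha _)) //.
  have hb : b (N + s)%N <= (1 - r) * (e / 2).
    have /= := hN (N + s)%N (leq_addr _ _); rewrite sub0r normrN => /ltW.
    exact: le_trans (ler_norm _).
  apply: le_trans (lerD (ler_wpM2l r0 IH) hb) _.
  by rewrite exprS mulrDr mulrA -addrA -mulrDl addrCA subrr addr0 mul1r.
have /cvgrPdist_lt/(_ _ e2)[N' _ hN'] : (fun s => r ^+ s * a N) @ \oo --> (0 : R).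
  by rewrite -[0](mul0r (a N)); apply: cvgMl; apply: cvg_expr; rewrite ger0_norm.
exists (N + N')%N => // t /= ht.
rewrite sub0r normrN ger0_norm //.
have Nt : (N <= t)%N by rewrite (leq_trans _ ht) ?leq_addr.
have := hN' (t - N)%N; rewrite /= leq_subRL // => /(_ ht).
rewrite sub0r normrN => /(le_lt_trans (ler_norm _)) hlt.
have := step (t - N)%N; rewrite subnKC // => /le_lt_trans; apply.
by rewrite [X in _ < X]splitr ltrD2r.
Qed.

Lemma cvg_cV0 n (x : nat -> 'cV[R]_n) :
  x @ \oo --> (0 : 'cV[R]_n)
  <-> forall i, (fun t => `|x t i 0|) @ \oo --> (0 : R).
Proof.
split=> [/cvg_ballP h i|h].
  apply/cvgrPdist_lt => e e0; apply: filterS (h e e0) => t /= [_ /(_ i 0)].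
  by rewrite mxE /ball /= !sub0r !normrN normr_id.
apply/cvg_ballP => e e0.
have : \forall t \near \oo, forall i, `|x t i 0| < e.
  apply: filter_forall => i.
  have /cvgrPdist_lt/(_ _ e0) := h i; apply: filterS => t /=.
  by rewrite sub0r normrN normr_id.
apply: filterS => t ht; split=> // i j.
by rewrite ord1 mxE /ball /= sub0r normrN.
Qed.

(* Each factor ('X - lam) turns the trajectory into the forcing term of a scalar
   recurrence with ratio lam, so the factors can be peeled off one by one. *)
Lemma cvg_horner_prod n (M : 'M[R[i]]_n.+1) (s : seq R[i]) :
  (forall lam, lam \in s -> `|lam| < 1) ->
  forall z : nat -> 'cV[R[i]]_n.+1, (forall t, z t.+1 = M *m z t) ->
  (forall t, horner_mx M (\prod_(lam <- s) ('X - lam%:P)) *m z t = 0) ->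
  forall i, (fun t => normc (z t i 0)) @ \oo --> (0 : R).
Proof.
elim: s => [|lam s IH] hs z hz.
  rewrite big_nil rmorph1 => h i.
  suff -> : (fun t => normc (z t i 0)) = (fun=> 0) by exact: cvg_cst.
  apply/funext => t; have := h t; rewrite mul1mx => ->.
  by rewrite mxE Normc.normc0.
rewrite big_cons => h i.
pose w t := M *m z t - lam *: z t.
have wE t : w t = horner_mx M ('X - lam%:P) *m z t.
  by rewrite rmorphB /= horner_mx_X horner_mx_C mulmxBl mul_scalar_mx.
have hw t : w t.+1 = M *m w t.
  by rewrite /w !hz mulmxBr scalemxAr.
have w0 : forall i, (fun t => normc (w t i 0)) @ \oo --> (0 : R).
  apply: IH => // [mu hmu|t]; first by apply: hs; rewrite inE hmu orbT.
  by rewrite wE mulmxA mulmxE -rmorphM mulrC h.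
apply: (cvg_affine_contraction (normc_ge0 lam) _ _ _ (w0 i)).
- by rewrite normc_ltr1 hs // inE eqxx.
- by move=> t; apply: normc_ge0.
- move=> t; rewrite -Normc.normcM.
  have -> : z t.+1 = lam *: z t + w t by rewrite hz /w addrC subrK.
  by rewrite [in X in X <= _]mxE [in X in X <= _]mxE; apply: normcD.
Qed.

(** Over the complex numbers the characteristic polynomial splits into factors with roots in the
    open unit disk, and by Cayley-Hamilton their product annihilates the trajectory. *)
Lemma schur_cvg n (A : 'M[R]_n) (x : nat -> 'cV[R]_n) :
  schur A -> (forall t, x t.+1 = A *m x t) -> x @ \oo --> (0 : 'cV[R]_n).
Proof.
case: n A x => [|n] A x /stable_char_poly sA hx; first by apply/cvg_cV0 => -[].
pose M := map_mx (real_complex R) A.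
have [s es] := closed_field_poly_normal (char_poly M).
have : lead_coef (char_poly M) = 1 by apply/monicP/char_poly_monic.
move=> lc; rewrite lc scale1r in es.
have hs lam : lam \in s -> `|lam| < 1.
  by move=> ls; apply: sA; rewrite map_char_poly es root_prod_XsubC.
apply/cvg_cV0 => i.
have := @cvg_horner_prod n M s hs (fun t => map_mx (real_complex R) (x t)).
move=> h.
have : (fun t => normc (map_mx (real_complex R) (x t) i 0)) @ \oo --> (0 : R).
  apply: h => t; first by rewrite hx map_mxM.
  by rewrite -es Cayley_Hamilton mul0mx.
by under eq_fun do rewrite mxE normcR.
Qed.

Lemma cvg_schur n (A : 'M[R]_n) :
  (forall x : nat -> 'cV[R]_n, (forall t, x t.+1 = A *m x t) ->
    x @ \oo --> (0 : 'cV[R]_n)) -> schur A.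
Proof.
move=> h lam /eigenvalueP[v vA v0].
have [j vj] : exists j, v 0 j != 0.
  apply/existsP; apply: contraNT v0; rewrite negb_exists => /forallP v0.
  by apply/eqP/rowP => j; rewrite mxE; apply/eqP; rewrite -[_ == _]negbK.
(* The eigenvector [v] is complex but trajectories are real: starting from a basis vector with
   [v 0 j != 0] gives [v x(t) = lam^t v_j], which is nonzero at time 0. *)
pose x t : 'cV[R]_n := iter t (mulmx A) (delta_mx j 0).
have vx t : v *m map_mx (real_complex R) (x t)
    = lam ^+ t *: (v *m map_mx (real_complex R) (x 0%N)).
  elim: t => [|t IH]; first by rewrite expr0 scale1r.
  by rewrite /= map_mxM mulmxA vA -scalemxAl IH scalerA -exprS.
have cx : (fun t => normc ((v *m map_mx (real_complex R) (x t)) 0 0)) @ \oo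
    --> (0 : R).
  apply: (@squeeze_cvgr _ _ _ _ (fun=> 0)
            (fun t => \sum_k normc (v 0 k) * `|x t k 0|)).
  - apply: nearW => t; rewrite normc_ge0 mxE /=.
    apply: (big_ind2 (fun z r => normc z <= r)); first by rewrite Normc.normc0.
      by move=> z r w s hz hw; rewrite (le_trans (normcD _ _)) // lerD.
    by move=> k _; rewrite Normc.normcM mxE normcR.
  - exact: cvg_cst.
  - suff hs (s : seq 'I_n) :
        (fun t => \sum_(k <- s) normc (v 0 k) * `|x t k 0|) @ \oo --> (0 : R).
      exact: (hs (index_enum _)).
    elim: s => [|k s IH]; first by under eq_fun do rewrite big_nil; exact: cvg_cst.
    under eq_fun do rewrite big_cons.
    have h0 : (fun t => normc (v 0 k) * `|x t k 0|) @ \oo --> (0 : R).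
      rewrite -(mulr0 (normc (v 0 k))); apply: cvgMr.
      by move: k; apply/cvg_cV0/h.
    by have := cvgD h0 IH; rewrite addr0; apply.
suff: normc lam < 1 by rewrite normc_ltr1.
(* If [lam] had modulus at least 1, the modulus of [lam^t v_j] would stay above that of [v_j] while
   tending to 0. *)
rewrite ltNge; apply/negP => lam1.
have : normc (v 0 j) <= 0.
  apply: (ler_cvg_to (cvg_cst _) cx); apply: nearW => t.
  rewrite vx /= map_delta_mx -colE mxE Normc.normcM.
  rewrite mxE ler_peMl ?normc_ge0 //.
  elim: t => [|t IH]; first by rewrite expr0 Normc.normc1.
  by rewrite exprS Normc.normcM mulr_ege1.
move=> hv; have /eqP : normc (v 0 j) = 0 by apply/eqP; rewrite eq_le hv normc_ge0.
by move/eqP/Normc.eq0_normc/eqP; apply/negP.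
Qed.

End Dynamics.

Ltac mxring := apply/matrixP => ? ?; rewrite !mxE; ring.

(** * Closed-loop responses *)

Section LoopEquations.
Variables (T : comUnitRingType) (n m p : nat).
Variables (Z P Q : 'M[T]_n) (B : 'M[T]_(n, m)) (C : 'M[T]_(p, n)).
Variable K : 'M[T]_(m, p).
Hypothesis QZ : Q *m Z = 1%:M.
Hypothesis ZP : (Z - B *m K *m C) *m P = 1%:M.

(** Here [Z] is [zI - A], [Q] its inverse and [P] is [Phi_xx]. This resolvent identity yields the
    constraint multiplying on the left, and [PZ] the one on the right. *)
Let Q_P : Q = P - Q *m B *m K *m C *m P.
Proof.
by rewrite -[in LHS](mulmx1 Q) -ZP mulmxBl mulmxBr [Q *m (Z *m P)]mulmxA QZ
  mul1mx !mulmxA.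
Qed.

Let PZ : P *m Z = 1%:M + P *m B *m K *m C.
Proof. by rewrite -(mulmx1C ZP) mulmxBr !mulmxA subrK. Qed.

Lemma loop_equations :
  let Phi := block_mx (C *m P) (C *m P *m B *m K + 1%:M) (K *m C *m P)
                      (K *m (C *m P *m B *m K + 1%:M)) in
  row_mx 1%:M (- (C *m Q *m B)) *m Phi = row_mx (C *m Q) 1%:M /\
  Phi *m col_mx Z (- C) = 0.
Proof.
split.
  rewrite mul_row_block !mul1mx !mulNmx; congr row_mx.
    by rewrite [in RHS]Q_P mulmxBr !mulmxA.
  have e : C *m P *m B *m K = C *m Q *m B *m K
      + C *m Q *m B *m K *m C *m P *m B *m K.
    by rewrite {1}Q_P mulmxBr !mulmxBl !mulmxA subrK.
  rewrite !mulmxDr !mulmx1 !mulmxA e.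
  by rewrite [X in _ - X]addrC addrAC subrr add0r.
rewrite mul_block_col -col_mx0; congr col_mx.
  rewrite mulmxN mulmxDl mul1mx -[C *m P *m Z]mulmxA PZ mulmxDr mulmx1 !mulmxA.
  by rewrite [X in _ - X]addrC subrr.
rewrite mulmxN -[K *m C *m P *m Z]mulmxA PZ !(mulmxDr, mulmxDl) !mulmx1 !mulmxA.
by rewrite [X in _ - X]addrC subrr.
Qed.

End LoopEquations.

(** * State-space form of the loop and stability of its responses *)

Section Loop.
Variable R : realType.
Local Notation z := (@zvar R)%:M.
Local Notation cst := (@constmx R _ _).

Lemma cvg_col_mx0 a b (x : nat -> 'cV[R]_a) (y : nat -> 'cV[R]_b) :
  (fun t => col_mx (x t) (y t)) @ \oo --> (0 : 'cV[R]_(a + b))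
  <-> x @ \oo --> (0 : 'cV[R]_a) /\ y @ \oo --> (0 : 'cV[R]_b).
Proof.
split=> [/cvg_cV0 h|[/cvg_cV0 hx /cvg_cV0 hy]].
  split; apply/cvg_cV0 => i.
    have := h (lshift b i).
    by under eq_fun do rewrite col_mxEu.
  have := h (rshift a i).
  by under eq_fun do rewrite col_mxEd.
apply/cvg_cV0 => i; case: (split_ordP i) => j ->.
  by under eq_fun do rewrite col_mxEu; apply: hx.
by under eq_fun do rewrite col_mxEd; apply: hy.
Qed.

(** State matrix of the loop in the coordinates [(x, xi)], with [u] and [y] eliminated. *)
Definition closed_loop_mx n m p k (A : 'M[R]_n) (B : 'M_(n, m)) (C : 'M_(p, n))
    (Ak : 'M_k) (Bk : 'M_(k, p)) (Ck : 'M_(m, k)) (Dk : 'M_(m, p)) : 'M_(n + k) :=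
  block_mx (A + B *m Dk *m C) (B *m Ck) (Bk *m C) Ak.

Lemma internally_stable_schur n m p k (A : 'M[R]_n) (B : 'M_(n, m))
    (C : 'M_(p, n)) (Ak : 'M_k) (Bk : 'M_(k, p)) (Ck : 'M_(m, k))
    (Dk : 'M_(m, p)) :
  internally_stable A B C Ak Bk Ck Dk ->
  schur (closed_loop_mx A B C Ak Bk Ck Dk).
Proof.
move=> st; apply: cvg_schur => x hx.
have hc t : col_mx (usubmx (x t)) (dsubmx (x t)) = x t by rewrite vsubmxK.
have hs t : col_mx (usubmx (x t.+1)) (dsubmx (x t.+1))
    = closed_loop_mx A B C Ak Bk Ck Dk *m col_mx (usubmx (x t)) (dsubmx (x t)).
  by rewrite !hc hx.
have -> : x = fun t => col_mx (usubmx (x t)) (dsubmx (x t)).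
  by apply/funext => t; rewrite hc.
apply/cvg_col_mx0.
apply: (st _ _ (fun t => Ck *m dsubmx (x t) + Dk *m (C *m usubmx (x t)))
               (fun t => C *m usubmx (x t))) => // t.
  have := hs t; rewrite mul_block_col => /eq_col_mx[-> _].
  by rewrite mulmxDl mulmxDr !mulmxA -addrA; congr (_ + _); rewrite addrC.
by have := hs t; rewrite mul_block_col => /eq_col_mx[_ ->]; rewrite addrC mulmxA.
Qed.

Section ClosedLoop.
Variables (n m p : nat) (A : 'M[R]_n) (B : 'M[R]_(n, m)) (C : 'M[R]_(p, n)).

Section State.
Variables (k : nat) (Ak : 'M[R]_k) (Bk : 'M[R]_(k, p)) (Ck : 'M[R]_(m, k)).
Variable Dk : 'M[R]_(m, p).
Local Notation K := (transfer Ak Bk Ck Dk).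
Local Notation Acl := (closed_loop_mx A B C Ak Bk Ck Dk).

(** Links the state-space and transfer descriptions: [X1] and [X2] are the plant and controller
    states under process noise [V1] and measurement noise [V2], [Y] is the measured output, and
    eliminating [X2] leaves [K] in the loop. *)
Lemma closed_loop_state b (V1 : 'M_(n, b)) (V2 : 'M_(p, b)) X1 X2 :
  (z - cst Acl) *m col_mx X1 X2
    = col_mx (V1 + cst B *m (cst Dk *m V2)) (cst Bk *m V2) ->
  let Y := cst C *m X1 + V2 in
  K *m Y = cst Ck *m X2 + cst Dk *m Y /\
  (z - cst A - cst B *m K *m cst C) *m X1 = V1 + cst B *m (K *m V2).
Proof.
rewrite zvar_constmx_block mul_block_col => /eq_col_mx[e1 e2] Y.
have KY : K *m Y = cst Ck *m X2 + cst Dk *m Y.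
  apply: transfer_state; rewrite /Y mulmxDr -e2 constmxM mulNmx !mulmxA.
  by rewrite addNKr.
split; first exact: KY.
have -> : V1 = (z - cst A) *m X1 - cst B *m (K *m Y).
  apply: (addIr (cst B *m (cst Dk *m V2))); rewrite -e1 KY /Y.
  rewrite constmxD !constmxM.
  rewrite !(mulmxDr, mulmxDl, mulmxBl, mulmxBr, mulNmx, mulmxN) !mulmxA.
  by mxring.
by rewrite /Y !(mulmxDr, mulmxDl, mulmxBl, mulmxN, mulNmx) !mulmxA; mxring.
Qed.

(** The plant component of the state response to process noise [1%:M] is a right inverse. *)
Lemma closed_loop_unit : z - cst A - cst B *m K *m cst C \in unitmx.
Proof.
pose X := resolvent Acl *m col_mx (1%:M : 'M_n) (0 : 'M_(k, n)).
have hX : (z - cst Acl) *m col_mx (usubmx X) (dsubmx X)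
    = col_mx (1%:M + cst B *m (cst Dk *m 0)) (cst Bk *m 0).
  by rewrite vsubmxK resolventK !mulmx0 addr0.
have [_] := closed_loop_state hX; rewrite !mulmx0 addr0.
by move=> h; case: (mulmx1_unit h) => ->.
Qed.

(** Output and control are constant combinations of the noise and of the joint state, whose response
    is the stable resolvent of [Acl] applied to stable data. *)
Lemma closed_loop_RHinf b (V1 : 'M_(n, b)) (V2 : 'M_(p, b)) :
  schur Acl -> RHinf V1 -> RHinf V2 ->
  let Y := cst C *m (Phi_xx A B C K *m (V1 + cst B *m (K *m V2))) + V2 in
  RHinf Y /\ RHinf (K *m Y).
Proof.
move=> sA rV1 rV2.
pose V := col_mx (V1 + cst B *m (cst Dk *m V2)) (cst Bk *m V2).
pose X := resolvent Acl *m V.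
have rX : RHinf X.
  apply: RHinf_mulmx; first exact: RHinf_resolvent.
  apply: RHinf_col_mx; last by apply: RHinf_mulmx => //; apply: RHinf_constmx.
  apply: RHinf_addmx => //.
  by do 2!(apply: RHinf_mulmx; first exact: RHinf_constmx).
have hX : (z - cst Acl) *m col_mx (usubmx X) (dsubmx X) = V.
  by rewrite vsubmxK resolventK.
have [] := closed_loop_state hX; set Y := _ + V2 => KY eX.
rewrite -eX /Phi_xx mulKmx; last exact: closed_loop_unit.
have rY : RHinf Y.
  apply: RHinf_addmx => //; apply: RHinf_mulmx; first exact: RHinf_constmx.
  exact: RHinf_usubmx.
rewrite -/Y; split=> //; rewrite KY; apply: RHinf_addmx.
  apply: RHinf_mulmx; [exact: RHinf_constmx | exact: RHinf_dsubmx].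
by apply: RHinf_mulmx => //; apply: RHinf_constmx.
Qed.

End State.


Lemma response_equations (K : 'M[ratfun R]_(m, p)) :
  z - cst A - cst B *m K *m cst C \in unitmx ->
  let Phi := block_mx (Phi_yx A B C K) (Phi_yy A B C K)
                      (Phi_ux A B C K) (Phi_uy A B C K) in
  row_mx 1%:M (- transfer A B C 0) *m Phi
    = row_mx (cst C *m resolvent A) 1%:M /\
  Phi *m col_mx (z - cst A) (- cst C) = 0.
Proof.
move=> u; rewrite /transfer constmx0 addr0.
apply: loop_equations; last exact: mulmxV.
exact/mulVmx/zvar_constmx_unit.
Qed.

End ClosedLoop.
End Loop.

(** * The observer-based controller *)

Section YoulaParameter.
Variables (T : comUnitRingType) (n m p : nat).
Variables (Z QA QL : 'M[T]_n) (B : 'M[T]_(n, m)) (C : 'M[T]_(p, n)).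
Variables (F : 'M[T]_(m, n)) (L : 'M[T]_(n, p)).
Variables (Yx : 'M[T]_(p, n)) (Ux : 'M[T]_(m, n)) (Y : 'M[T]_p) (U : 'M[T]_(m, p)).
Hypothesis ZQA : Z *m QA = 1%:M.
Hypothesis ZQL : (Z - L *m C) *m QL = 1%:M.
Hypothesis YE : Y - C *m QA *m B *m U = 1%:M.
Hypothesis YxE : Yx *m Z = Y *m C.
Hypothesis UxE : Ux *m Z = U *m C.

Let X := QL *m (B *m U - L *m Y).

Lemma innovationE : Y - C *m X = 1%:M + C *m QL *m L.
Proof.
(* The plant state minus the observer state: the estimation error obeys [A + L C] driven by the
   noise alone, so [U] cancels. *)
have eX : QA *m B *m U - X = QL *m L.
  rewrite -[LHS]mul1mx -(mulmx1C ZQL) -!mulmxA; congr (_ *m _).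
  rewrite mulmxBr /X [_ *m (QL *m _)]mulmxA ZQL mul1mx mulmxBl !mulmxA ZQA mul1mx.
  by rewrite -[in RHS](mulmx1 L) -YE mulmxBr !mulmxA opprB [LHS]addrC addrA subrK.
rewrite -mulmxA -eX mulmxBr addrA !mulmxA -YE.
by rewrite subrK.
Qed.

(* X is the response of the observer state to the measurement noise, Y - C X that
   of the innovation; youla is the transfer matrix from the innovation to u - F X. *)
Definition youla : 'M[T]_(m, p) :=
  U - Ux *m L - F *m QL *m (B *m (U - Ux *m L) - L *m (Y - Yx *m L)).

(** The constraints give [Ux = U C QA] and [Yx = Y C QA], so [youla] factors as
    [(U - F X) (1 - C QA L)], and the last factor is inverse to the innovation [1 + C QL L]. The
    unfactored definition avoids [QA], which may be unstable. *)
Lemma youla_innovation : youla *m (Y - C *m X) = U - F *m X.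
Proof.
have ux : Ux = U *m C *m QA by rewrite -UxE -mulmxA ZQA mulmx1.
have yx : Yx = Y *m C *m QA by rewrite -YxE -mulmxA ZQA mulmx1.
have -> : youla = (U - F *m X) *m (1%:M - C *m QA *m L).
  have factor a (V : 'M_(a, p)) :
      V - V *m C *m QA *m L = V *m (1%:M - C *m QA *m L).
    by rewrite mulmxBr mulmx1 !mulmxA.
  rewrite /youla ux yx !factor [RHS]mulmxBl; congr (_ - _).
  by rewrite /X -!mulmxA mulmxBl -!mulmxA.
have QLE : QL = QA + QA *m L *m C *m QL.
  transitivity (QA *m (1%:M + L *m C *m QL)); last first.
    by rewrite mulmxDr mulmx1 !mulmxA.
  rewrite -[LHS]mul1mx -[in LHS](mulmx1C ZQA) -[LHS]mulmxA; congr (_ *m _).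
  by rewrite -ZQL mulmxBl subrK.
rewrite innovationE -[RHS]mulmx1 -mulmxA; congr (_ *m _).
have b : C *m QL *m L = C *m QA *m L + C *m QA *m L *m (C *m QL *m L).
  by rewrite {1}QLE mulmxDr mulmxDl !mulmxA.
by rewrite mulmxBl mul1mx [X in _ - X]mulmxDr mulmx1 -b addrK.
Qed.

End YoulaParameter.

Section Youla.
Variable R : realType.
Local Notation z := (@zvar R)%:M.
Local Notation cst := (@constmx R _ _).
Variables (n m p k : nat) (A : 'M[R]_n) (B : 'M[R]_(n, m)) (C : 'M[R]_(p, n)).
Variables (F : 'M[R]_(m, n)) (L : 'M[R]_(n, p)).
Variables (Aq : 'M[R]_k) (Bq : 'M[R]_(k, p)) (Cq : 'M[R]_(m, k)) (Dq : 'M[R]_(m, p)).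

(** State [(xhat, q)]: the observer [xhat+ = (A + L C) xhat + B u - L y], the Youla system
    [q+ = Aq q + Bq (y - C xhat)], and [u = F xhat + Cq q + Dq (y - C xhat)] substituted into the
    observer. *)
Let Ak := block_mx (A + B *m F + L *m C - B *m Dq *m C) (B *m Cq) (- (Bq *m C)) Aq.
Let Bk := col_mx (B *m Dq - L) Bq.
Let Ck := row_mx (F - Dq *m C) Cq.

Lemma observer_stabilizable :
  schur (A + B *m F) -> schur Aq -> stabilizable Ak Bk.
Proof.
(* With [y = C xhat] the innovation vanishes: [xhat] no longer drives [q] and evolves with
   [A + B F]. *)
move=> sF sq; exists (row_mx C 0).
rewrite mul_col_row !mulmx0 add_block_mx !addr0 addNr.
have -> : A + B *m F + L *m C - B *m Dq *m C + (B *m Dq - L) *m C = A + B *m F.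
  by rewrite mulmxBl addrA subrK addrK.
exact: schur_ublock.
Qed.

Lemma observer_detectable :
  schur (A + L *m C) -> schur Aq -> detectable Ak Ck.
Proof.
(* Injecting [- B u] cancels the control in the observer, leaving [A + L C] with no influence of
   [q]. *)
move=> sL sq; exists (col_mx (- B) 0).
rewrite mul_col_row !mul0mx add_block_mx !addr0 !mulNmx subrr.
have -> : A + B *m F + L *m C - B *m Dq *m C - B *m (F - Dq *m C) = A + L *m C.
  rewrite mulmxBr opprB mulmxA addrA subrK.
  by rewrite addrAC addrK.
exact: schur_lblock.
Qed.

(* In the coordinates (x - xhat, q, xhat) the loop is block lower triangular. *)
Lemma observer_internally_stable :
  schur (A + B *m F) -> schur (A + L *m C) -> schur Aq ->
  internally_stable A B C Ak Bk Ck Dq.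
Proof.
move=> sF sL sq x xi u y hx hy hxi hu.
pose h t := usubmx (xi t); pose q t := dsubmx (xi t).
have xiE t : xi t = col_mx (h t) (q t) by rewrite vsubmxK.
have uE t : u t = F *m h t + Cq *m q t + Dq *m (C *m (x t - h t)).
  rewrite hu xiE hy mul_row_col mulmxBl !mulmxBr !mulmxA.
  by rewrite -!addrA; congr (_ + _); rewrite addrCA [- _ + _]addrC.
have hq t : col_mx (h t.+1) (q t.+1) =
    col_mx (A *m h t + B *m u t - L *m (C *m (x t - h t)))
           (Bq *m (C *m (x t - h t)) + Aq *m q t).
  rewrite -xiE hxi xiE mul_block_col mul_col_mx add_col_mx hy uE; congr col_mx.
    rewrite !(mulmxBl, mulmxDl, mulmxBr, mulmxDr, mulNmx) !mulmxA; mxring.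
  by rewrite mulNmx !mulmxBr !mulmxA; mxring.
pose M := block_mx (A + L *m C) 0 (col_mx (Bq *m C) (B *m Dq *m C - L *m C))
   (block_mx Aq 0 (B *m Cq) (A + B *m F)).
have sM : schur M by do 2!apply: schur_lblock => //.
pose w t := col_mx (x t - h t) (col_mx (q t) (h t)).
have hw t : w t.+1 = M *m w t.
  have [h1 h2] := eq_col_mx (hq t).
  rewrite /w /M h1 h2 hx !mul_block_col mul_col_mx add_col_mx !mul0mx !addr0.
  congr col_mx; first by rewrite mulmxDl !mulmxBr !mulmxA; mxring.
  congr col_mx; first by rewrite !mulmxA.
  rewrite uE !(mulmxBl, mulmxDl, mulmxBr, mulmxDr, mulNmx) !mulmxA; mxring.
have /cvg_col_mx0[e0 /cvg_col_mx0[q0 h0]] := schur_cvg sM hw.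
have -> : xi = fun t => col_mx (h t) (q t) by apply/funext.
split; last exact/cvg_col_mx0.
suff : (fun t => x t - h t + h t) @ \oo --> (0 : 'cV[R]_n).
  by under eq_fun do rewrite subrK.
by have := cvgD e0 h0; rewrite addr0; apply.
Qed.

(** With [S] the Youla state driven by the innovation, [(X, S)] is a state response of the
    controller to [Y] whose output is [U], so [transfer_state] applies. *)
Lemma observer_transfer b (X : 'M_(n, b)) (Y : 'M_(p, b)) (U : 'M_(m, b)) :
  (z - cst (A + L *m C)) *m X = cst B *m U - cst L *m Y ->
  transfer Aq Bq Cq Dq *m (Y - cst C *m X) = U - cst F *m X ->
  transfer Ak Bk Ck Dq *m Y = U.
Proof.
move=> hX.
set E := Y - _.
have [S hS] : exists S, (z - cst Aq) *m S = cst Bq *m E.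
  by exists (resolvent Aq *m (cst Bq *m E)); rewrite resolventK.
rewrite (transfer_state _ _ hS) => hU.
have {hU}UE : U = cst F *m X + cst Cq *m S + cst Dq *m E.
  by rewrite -addrA hU addrC subrK.
rewrite (@transfer_state _ _ _ _ _ _ _ _ _ (col_mx X S)).
  rewrite UE constmx_row mul_row_col /E constmxD constmxN constmxM.
  by rewrite !(mulmxDl, mulmxBr, mulNmx) !mulmxA; mxring.
rewrite zvar_constmx_block mul_block_col constmx_col mul_col_mx.
congr col_mx; last first.
  by rewrite hS /E constmxN constmxM opprK mulmxBr !mulmxA addrC subrK.
have -> : z - cst (A + B *m F + L *m C - B *m Dq *m C)
    = z - cst (A + L *m C) - cst B *m (cst F - cst Dq *m cst C).
  rewrite !constmxD constmxN !constmxM mulmxBr mulmxA; move: z => z; mxring.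
rewrite mulmxBl hX UE /E !constmxD constmxN !constmxM.
by rewrite !(mulmxDl, mulmxDr, mulmxBr, mulmxBl, mulNmx, mulmxN) !mulmxA; mxring.
Qed.

End Youla.

(** * Closed-loop responses and stabilizing controllers *)

Theorem proposition3 (R : realType) (n m p : nat)
    (A : 'M[R]_n) (B : 'M[R]_(n, m)) (C : 'M[R]_(p, n))
    (stabAB : stabilizable A B) (detAC : detectable A C) :
  (forall K : 'M[ratfun R]_(m, p), Cstab A B C K ->
     response_constraints A B C
       (Phi_yx A B C K) (Phi_ux A B C K) (Phi_yy A B C K) (Phi_uy A B C K))
  /\
  (forall (Pyx : 'M[ratfun R]_(p, n)) (Pux : 'M[ratfun R]_(m, n))
          (Pyy : 'M[ratfun R]_p) (Puy : 'M[ratfun R]_(m, p)),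
     response_constraints A B C Pyx Pux Pyy Puy ->
     Pyy \in unitmx /\ Cstab A B C (Puy *m invmx Pyy)).
Proof.
split.
  move=> _ [_ [k [Ak [Bk [Ck [Dk [-> _ _ st]]]]]]].
  have sA := internally_stable_schur st.
  have [e1 e2] := response_equations (closed_loop_unit A B C Ak Bk Ck Dk).
  split=> //.
  have r1 a : RHinf (1%:M : 'M[ratfun R]_a).
    by rewrite -constmx1; apply: RHinf_constmx.
  have r0 a b : RHinf (0 : 'M[ratfun R]_(a, b)).
    by rewrite -constmx0; apply: RHinf_constmx.
  (* Noise [(1, 0)] produces [Phi_yx] and [Phi_ux]; noise [(0, 1)] below produces [Phi_yy] and
     [Phi_uy]. *)
  have := closed_loop_RHinf sA (r1 n) (r0 p n).
  rewrite /= !mulmx0 !addr0 mulmx1 mulmxA => -[hyx hux].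
  have := closed_loop_RHinf sA (r0 n p) (r1 p).
  by rewrite /= mulmx1 add0r !mulmxA => -[hyy huy].
move=> Pyx Pux Pyy Puy [e1 e2 [ryx rux ryy ruy]].
have [F sF] := stabAB; have [L sL] := detAC.
(* Extracts [Pyy - G Puy = 1], [Pyx (zI - A) = Pyy C] and [Pux (zI - A) = Puy C], the hypotheses of
   [youla_innovation]. *)
move: e1; rewrite mul_row_block !mul1mx !mulNmx => /eq_row_mx[_ eyy].
move: e2; rewrite mul_block_col -col_mx0 !mulmxN => /eq_col_mx[/eqP + /eqP].
rewrite !subr_eq0 => /eqP eyx /eqP eux.
pose z := (@zvar R)%:M - constmx A.
have zL : z - constmx L *m constmx C = (@zvar R)%:M - constmx (A + L *m C).
  by rewrite constmxD constmxM opprD addrA.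
have zA : z *m resolvent A = 1%:M by exact/mulmxV/zvar_constmx_unit.
have zLr : (z - constmx L *m constmx C) *m resolvent (A + L *m C) = 1%:M.
  by rewrite zL; exact/mulmxV/zvar_constmx_unit.
have YE : Pyy - constmx C *m resolvent A *m constmx B *m Puy = 1%:M.
  by rewrite -eyy /transfer constmx0 addr0.
have := youla_innovation (constmx F) zA zLr YE eyx eux.
set Q := youla _ _ _ _ _ _ _ _.
set X := resolvent (A + L *m C) *m _ => hQ.
(* [Q] is assembled from the given responses, constants and the resolvent of the Schur matrix
   [A + L C]. *)
have : RHinf Q.
  have rV : RHinf (Pyy - Pyx *m constmx L).
    apply: RHinf_addmx => //; apply: RHinf_oppmx.
    by apply: RHinf_mulmx => //; apply: RHinf_constmx.
  have rW : RHinf (Puy - Pux *m constmx L).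
    apply: RHinf_addmx => //; apply: RHinf_oppmx.
    by apply: RHinf_mulmx => //; apply: RHinf_constmx.
  apply: RHinf_addmx => //; apply: RHinf_oppmx.
  apply: RHinf_mulmx.
    by apply: RHinf_mulmx; [apply: RHinf_constmx|apply: RHinf_resolvent].
  apply: RHinf_addmx; last apply: RHinf_oppmx.
    by apply: RHinf_mulmx => //; apply: RHinf_constmx.
  by apply: RHinf_mulmx => //; apply: RHinf_constmx.
case/RHinf_stably_realizable => k [Aq [Bq [Cq [Dq [sq eQ]]]]].
rewrite eQ in hQ.
have hX : ((@zvar R)%:M - constmx (A + L *m C)) *m X
    = constmx B *m Puy - constmx L *m Pyy by rewrite /X resolventK.
have hK := observer_transfer hX hQ.
set Kc := transfer _ _ _ _ in hK.
have uY : Pyy \in unitmx.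
  have : (1%:M - transfer A B C 0 *m Kc) *m Pyy = 1%:M.
    by rewrite mulmxBl mul1mx -mulmxA hK eyy.
  by move=> h; case: (mulmx1_unit h) => _ ->.
split=> //.
have -> : Puy *m invmx Pyy = Kc by rewrite -hK mulmxK.
split; first exact: proper_transfer.
do 5![eexists]; split; first by reflexivity.
- exact: observer_stabilizable.
- exact: observer_detectable.
- exact: observer_internally_stable.
Qed.
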